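(* Let $(\xi_n)_{n\in\mathbb{N}}\subset L^0_+$ be a sequence of nonnegative random variables on a probability space $(\Omega,\mathscr{F},\mathbb{P})$, let $(\xi_{n_k})_{k\in\mathbb{N}}$ be a subsequence and let $\xi:\Omega\to[0,\infty]$ be a nonnegative random variable such that (a) $(\xi_{n_k})_{k\in\mathbb{N}}$ is $\mathbb{P}$-almost surely Cesàro convergent to $\xi$; and (b) there exists an equivalent probability measure $\mathbb{Q}\approx\mathbb{P}$ such that the sequence $(\xi_{n_k}\mathbf{1}_{\{\xi<\infty\}})_{k\in\mathbb{N}}$ is $L^1(\mathbb{Q})$-bounded. Let $\bar\xi_{n_k}:=\frac1k\sum_{l=1}^k\xi_{n_l}$ for $k\in\mathbb{N}$, and let $C:=\mathrm{conv}\{\xi_{n_k}:k\in\mathbb{N}\}$ and $\bar C:=\mathrm{conv}\{\bar\xi_{n_k}:k\in\mathbb{N}\}$. Then the following statements are equivalent: (i) $\xi<\infty$ almost surely. (ii) The set $C$ is bounded in probability. (iii) The set $\bar C$ is bounded in probability. (iv) There exists an equivalent probability measure $\mathbb{Q}\approx\mathbb{P}$ such that the sequence $(\xi_{n_k})_{k\in\mathbb{N}}$ is $L^1(\mathbb{Q})$-bounded. (v) There exists an equivalent probability measure $\mathbb{Q}\approx\mathbb{P}$ such that the sequence $(\bar\xi_{n_k})_{k\in\mathbb{N}}$ is $L^1(\mathbb{Q})$-bounded. (vi) For every sequence $(\eta_n)_{n\in\mathbb{N}}\subset C$ there is a subsequence $(\eta_{m_k})_{k\in\mathbb{N}}$ such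 that the distributions $(\mathbb{P}\circ\eta_{m_k})_{k\in\mathbb{N}}$ converge weakly. (vii) For every sequence $(\bar\eta_n)_{n\in\mathbb{N}}\subset\bar C$ there is a subsequence $(\bar\eta_{m_k})_{k\in\mathbb{N}}$ such that the distributions $(\mathbb{P}\circ\bar\eta_{m_k})_{k\in\mathbb{N}}$ converge weakly.
   Context: $L^0=L^0(\Omega,\mathscr{F},\mathbb{P})$ is the space of equivalence classes (modulo $\mathbb{P}$-almost sure equality) of real-valued random variables, and $L^0_+$ is the convex cone of all $X\in L^0$ with $\mathbb{P}(X\ge 0)=1$. A sequence $(X_k)_{k\in\mathbb{N}}\subset L^0_+$ is $\mathbb{P}$-almost surely Cesàro convergent to $X:\Omega\to[0,\infty]$ if $\frac1k\sum_{l=1}^k X_l\to X$ $\mathbb{P}$-almost surely in $[0,\infty]$. For a probability measure $\mathbb{Q}$ equivalent to $\mathbb{P}$ (written $\mathbb{Q}\approx\mathbb{P}$; same null sets), a set $K\subset L^0$ is $L^1(\mathbb{Q})$-bounded if $\sup_{X\in K}\mathbb{E}_{\mathbb{Q}}[|X|]<\infty$; a sequence is $L^1(\mathbb{Q})$-bounded if the set of its members is. A set $K\subset L^0$ is bounded in probability if for every $\epsilon>0$ there is $M>0$ with $\sup_{X\in K}\mathbb{P}(|X|>M)<\epsilon$. $\mathrm{conv}$ denotes the convex hull (finite convex combinations). $\mathbb{P}\circ X$ denotes the distribution of $X$ under $\mathbb{P}$; weak convergence means weak convergence to a probability measure on $(\mathbb{R},\mathscr{B}(\mathbb{R}))$.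 *)

(* Defs.v *)
From HB Require Import structures.
From mathcomp Require Import all_boot all_order all_algebra.
From mathcomp Require Import all_classical all_reals all_analysis.
From mathcomp Require Import measurable_realfun.

Set Implicit Arguments.
Unset Strict Implicit.
Unset Printing Implicit Defensive.

Import Order.TTheory GRing.Theory Num.Theory.
Import numFieldNormedType.Exports.

Local Open Scope classical_set_scope.
Local Open Scope ring_scope.

(* An element of L^0 is given by a representative [X : {RV P >-> R}]; a subset
   of L^0 is a set of random variables. The notions below depend only on the
   P-a.s. equality classes ([L1_bounded Q] as soon as Q is equivalent to P). *)

Section L0.
Context {d : measure_display} {T : measurableType d} {R : realType}.

Definition equivalent_prob (Q P : probability T R) : Prop :=
  Q `<< P /\ P `<< Q.

(* Stated for plain functions, so that it applies to families such as
   [X * \1_A] without bundling their measurability. *)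
Definition L1_bounded (Q : probability T R) (K : set (T -> R)) : Prop :=
  (ereal_sup [set 'E_Q[(fun w => `|X w|)%R] | X in K] < +oo)%E.

Variable P : probability T R.

Definition L0_nonneg (X : {RV P >-> R}) : Prop :=
  P [set w | 0 <= X w] = 1%E.

Definition bounded_in_probability (K : set {RV P >-> R}) : Prop :=
  forall e : R, 0 < e -> exists2 M : R, 0 < M &
    (ereal_sup [set P [set w | (M < `|X w|)%R] | X in K] < e%:E)%E.

(* Closed under P-a.s. equality by construction: these are all the
   representatives of the convex combinations of classes of elements of K. *)
Definition conv_hull (K : set {RV P >-> R}) : set {RV P >-> R} :=
  [set X | exists (N : nat) (c : 'I_N -> R) (Y : 'I_N -> {RV P >-> R}),
    [/\ forall i, 0 <= c i,
        \sum_(i < N) c i = 1,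
        forall i, K (Y i) &
        {ae P, forall w, X w = \sum_(i < N) c i * Y i w}]].

(* Sequences are indexed from 0, so [cesaro_mean X k] averages the first k + 1
   terms [X 0, ..., X k]. *)
Definition cesaro_mean (X : nat -> {RV P >-> R}) (k : nat) : {RV P >-> R} :=
  scale_mfun (k.+1%:R^-1) (\sum_(l < k.+1) (X l : {mfun T >-> R})).

Definition cesaro_ae_cvg (X : nat -> {RV P >-> R}) (Y : T -> \bar R) : Prop :=
  {ae P, forall w, (cesaro_mean X k w)%:E @[k --> \oo] --> Y w}.

End L0.

Definition weakly_cvg {R : realType}
    (mu : nat -> probability R R)
    (nu : probability R R) : Prop :=
  forall f : R -> R, continuous f -> bounded_fun f ->
    'E_(mu k)[f]%E @[k --> \oo] --> 'E_nu[f]%E.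

Definition weakly_convergent {R : realType}
    (mu : nat -> probability R R) : Prop :=
  exists nu : probability R R, weakly_cvg mu nu.

Definition strictly_increasing (m : nat -> nat) : Prop :=
  {homo m : i j / (i < j)%N}.

(* Main.v *)
Require Import Defs.
From HB Require Import structures.
From mathcomp Require Import all_boot all_order all_algebra.
From mathcomp Require Import all_classical all_reals all_analysis.
From mathcomp Require Import measurable_realfun.
From mathcomp Require Import ring lra.

Set Implicit Arguments.
Unset Strict Implicit.
Unset Printing Implicit Defensive.

Import Order.TTheory GRing.Theory Num.Theory.
Import numFieldNormedType.Exports.

Local Open Scope classical_set_scope.
Local Open Scope ring_scope.

(* Everything is linked to (i). If (i) holds, the measure Q of assumption (b)
   bounds the sequence itself in L^1(Q), hence its convex hull; Markov's
   inequality under Q and P << Q then give boundedness in probability under P,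
   and boundedness in probability (tightness) gives weakly convergent
   subsequences. Conversely, each of (ii)-(vii) yields a subsequence of the
   Cesaro means whose laws converge weakly to a probability measure; as the
   Cesaro means tend to xi almost surely, that limit would lose the mass
   P(xi = +oo), which must therefore vanish.

   Prokhorov's theorem on the line is obtained through quantile functions:
   X has the law of its quantile function on ]0, 1[, tightness bounds quantile
   functions pointwise, and Helly's selection theorem extracts a subsequence of
   quantile functions converging off a countable set; the limit law is that of
   the limit function, by dominated convergence. *)

(** * Measurable comparison sets and diagonal extraction *)

Lemma measurable_set_le d (T : measurableType d) (R : realType) (f g : T -> R) :
  measurable_fun setT f -> measurable_fun setT g ->
  measurable [set w | f w <= g w].
Proof.
by move=> mf mg; rewrite -[X in measurable X]setTI; exact: measurable_fun_le.
Qed.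

Lemma measurable_set_lt d (T : measurableType d) (R : realType) (f g : T -> R) :
  measurable_fun setT f -> measurable_fun setT g ->
  measurable [set w | f w < g w].
Proof.
move=> mf mg; rewrite [X in measurable X](_ : _ = ~` [set w | g w <= f w]).
  by apply: measurableC; exact: measurable_set_le.
by apply/seteqP; split => w /=; rewrite ltNge => /negP.
Qed.

(* A diagonal extraction: Tychonoff's theorem provides a cluster point, which is
   then approached on the first k coordinates. *)
Lemma pointwise_subsequence (R : realType) (I : countType) (a : nat -> I -> R)
    (M : I -> R) : (forall k i, `|a k i| <= M i) ->
  exists m : nat -> nat, strictly_increasing m /\
    exists l : I -> R, forall i, a (m k) i @[k --> \oo] --> l i.
Proof.
move=> aM; pose T := prod_topology (fun _ : I => R).
have cA : compact [set f : T | forall i, `[- M i, M i]%classic (f i)].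
  exact: (@tychonoff I (fun _ => R) (fun i => `[- M i, M i]%classic)
    (fun i => @segment_compact R _ _)).
have [|l [_ cl]] := cA ((a : nat -> T) @ \oo) _.
  by exists 0%N => // k _ i; rewrite /= in_itv/= -ler_norml.
(* A neighbourhood of [l] in the product topology constrains finitely many coordinates, here those
   of code below [j]; clustering gives terms of arbitrarily large index in it. *)
have step j N : exists n, (N < n)%N /\
    forall i : I, (pickle i < j)%N -> `|l i - a n i| < j.+1%:R^-1.
  have lj : nbhs l
      [set f | forall p : 'I_j, forall i : I, pickle i = p ->
        `|l i - f i| < j.+1%:R^-1].
    apply: (@filter_forall T 'I_j
      (fun p => [set f | forall i : I, pickle i = p ->
        `|l i - f i| < j.+1%:R^-1]) (nbhs l)) => -[p /= pj].
    have [[i pi]|np] := pselect (exists i : I, pickle i = p); last first.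
      by apply: (@filterE T (nbhs l)) => f i ip; exfalso; apply: np; exists i.
    have j0 : 0 < j.+1%:R^-1 :> R by rewrite invr_gt0 ltr0n.
    have := @proj_continuous I (fun _ => R) i l _ (nbhsx_ballx (l i) _ j0).
    apply: (@filterS T (nbhs l)) => f /= lf i' pi'.
    by rewrite (pcan_inj pickleK (etrans pi' (esym pi))).
  have aN : ((a : nat -> T) @ \oo) [set a n | n in [set n | (N < n)%N]].
    by exists N.+1 => // n /= Nn; exists n.
  have [_ [[n Nn <-] nj]] := cl _ _ aN lj; exists n; split => // i ij.
  exact: nj (Ordinal ij) i erefl.
have [g gP] := choice (fun jN : nat * nat => step jN.1 jN.2).
pose m := fix m k := if k is k'.+1 then g (k', m k') else 0%N.
have mS k : (m k < m k.+1)%N by have [] := gP (k, m k).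
have mlt : strictly_increasing m.
  by apply: homo_ltn => //; exact: ltn_trans.
exists m; split => //; exists l => i.
(* The shift matters: it is [m k.+1], chosen at stage [k], that is within [k.+1%:R^-1] of the limit
   on the codes below [k]. *)
rewrite -(cvg_shiftS (fun k => a (m k) i)); apply/cvgrPdist_lt => e e0.
near=> k; have [_ /(_ i)/=] := gP (k, m k).
have ik : (pickle i < k)%N by near: k; exact: nbhs_infty_gt.
move=> /(_ ik) /lt_trans; apply.
by near: k; exact: (near_infty_natSinv_lt (PosNum e0)).
Unshelve. all: by end_near. Qed.

(** * Quantile functions and their bounds under tightness *)

Section quantile.
Context d (T : measurableType d) (R : realType) (P : probability T R).
Variable X : {RV P >-> R}.

Let F (x : R) : R := fine (P [set w | X w <= x]).

Let FE x : P [set w | X w <= x] = (F x)%:E.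
Proof. by rewrite fineK// fin_num_measure//; exact: measurable_set_le. Qed.

Let F_cdf : F = fine \o cdf X.
Proof.
by apply/funext => x; rewrite /F /cdf /distribution /pushforward /= set_itvE.
Qed.

Let F_nd x y : x <= y -> F x <= F y.
Proof.
by move=> xy; rewrite F_cdf/= fine_le ?fin_num_measure// cdf_nondecreasing.
Qed.

(* Meaningful for [0 < u < 1] only: otherwise the set may be empty or unbounded
   below, and its [inf] is 0. *)
Definition quantile (u : R) : R :=
  inf [set x | u%:E <= P [set w | (X w <= x)%R]]%E.

(** The set is nonempty because [F] tends to 1 at +oo, and bounded below because [F] tends to 0 at
    -oo. *)
Let has_inf_quantile u : 0 < u < 1 -> has_inf [set x | u <= F x].
Proof.
move=> /andP[u0 u1]; split.
  have : \forall x \near +oo, u < F x.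
    by apply: (cvgr_gt 1) => //; rewrite F_cdf; apply: fine_cvg; exact: cvg_cdfy1.
  by move=> /filter_ex[x ux]; exists x; exact: ltW.
have : \forall x \near -oo, F x < u.
  by apply: (cvgr_lt 0) => //; rewrite F_cdf; apply: fine_cvg; exact: cvg_cdfNy0.
(* The filter at -oo controls [F] strictly below [b] only, hence the bound [b - 1]. *)
move=> [b [_ Fb]]; exists (b - 1) => x /= uFx; rewrite leNgt; apply/negP => xb.
have := Fb (b - 1); rewrite ltrBlDr ltrDl ltr01 => /(_ isT); apply/negP.
by rewrite -leNgt (le_trans uFx)// F_nd// ltW.
Qed.

(** This is the Galois connection between quantile and distribution functions. From left to right it
    rests on right continuity: if [F x < u], then still [F y < u] for some [y > x], although a point
    [z < y] of the set satisfies [u <= F z]. *)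
Lemma quantile_le u x : 0 < u < 1 ->
  (quantile u <= x) = (u%:E <= P [set w | (X w <= x)%R])%E.
Proof.
move=> u01; have hi := has_inf_quantile u01.
have -> : quantile u = inf [set x | u <= F x].
  by congr inf; apply/seteqP; split => y /=; rewrite FE.
rewrite FE lee_fin; apply/idP/idP => [qx|uFx]; last first.
  by apply: ge_inf => //; exact: hi.2.
have FX : F y @[y --> x^'+] --> F x.
  rewrite F_cdf; apply: fine_cvg; rewrite fineK ?fin_num_measure//.
  exact: cdf_right_continuous.
rewrite leNgt; apply/negP => Fxu.
have Fu : \forall y \near x^'+, F y < u by exact: (cvgr_lt (F x)).
have xgt := nbhs_right_gt x.
have [y [Fyu /= xy]] : exists y, F y < u /\ x < y.
  have [y ?] := @filter_ex _ _ (at_right_proper_filter x) _ (filterI Fu xgt).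
  by exists y.
have yq : 0 < y - inf [set x | u <= F x] by rewrite subr_gt0 (le_lt_trans qx).
have [z uz] := inf_adherent yq hi.
rewrite addrC subrK => zy.
by move: Fyu; rewrite ltNge (le_trans uz)// F_nd// ltW.
Qed.

Lemma quantile_nd : {in `]0, 1[ &, nondecreasing_fun quantile}.
Proof.
move=> u v; rewrite !in_itv/= => u01 v01 uv.
rewrite quantile_le// (le_trans (_ : _ <= v%:E)%E) ?lee_fin//.
by rewrite -quantile_le.
Qed.

(** The term [1 - u] of the minimum gives P(X <= M) >= u, hence the upper bound. The term [u] gives
    the lower one: were the quantile below [- M], the event that X is at most the quantile, of
    probability at least [u], would lie in |X| > M. *)
Lemma quantile_bound u M : 0 < u < 1 ->
  (P [set w | (M < `|X w|)%R] < (Num.min u (1 - u))%:E)%E ->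
  `|quantile u| <= M.
Proof.
move=> u01; set A := [set w | _] => PM.
have mA : measurable A.
  by apply: measurable_set_lt => //; exact: measurableT_comp.
have mX x : measurable [set w | X w <= x].
  exact: measurable_set_le.
rewrite ler_norml; apply/andP; split; last first.
  rewrite quantile_le//.
  have : ((1 - u)%:E > P A)%E.
    by rewrite (lt_le_trans PM)// lee_fin ge_min lexx orbT.
  have : (1 - P A <= P [set w | (X w <= M)%R])%E.
    rewrite -probability_setC// le_measure ?inE//; first exact: measurableC.
    move=> w /=; rewrite /A /= => /negP; rewrite -leNgt.
    exact: le_trans (ler_norm _).
  rewrite -(fineK (fin_num_measure P _ mA)) FE !lee_fin lte_fin.
  by lra.
rewrite leNgt; apply/negP => qM.
have : (u%:E <= P [set w | (X w <= quantile u)%R])%E by rewrite -quantile_le.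
apply/negP; rewrite -ltNge.
apply: le_lt_trans (lt_le_trans PM _); last by rewrite lee_fin ge_min lexx.
rewrite le_measure ?inE// => w /= Xq; rewrite /A/= lter_normr.
by apply/orP; right; rewrite ltrNr (le_lt_trans Xq).
Qed.

End quantile.

(** By monotonicity, the points of []a, b[] mapped into a right ray form an interval, and such rays
    generate the Borel sets. *)
Lemma measurable_nondecreasing_itv (R : realType) (a b : R) (f : R -> R) :
  {in `]a, b[ &, nondecreasing_fun f} -> measurable_fun setT (f \_ `]a, b[).
Proof.
move=> fnd; apply/(measurable_restrictT _ _).1 => //.
move=> _; apply: (measurability _ (RGenCInfty.measurableE R)) => //.
move=> _ [_ [r ->] <-]; apply: is_interval_measurable => s t/=.
rewrite !in_itv/= !andbT => -[/andP[as_ sb] rs] [/andP[at_ tb] rt] u.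
move=> /andP[su ut]; have uab : u \in `]a, b[.
  by rewrite in_itv/= (lt_le_trans as_ su) (le_lt_trans ut tb).
split; first by rewrite in_itv/= in uab.
by rewrite in_itv/= andbT (le_trans rs)// fnd// in_itv/= as_ sb.
Qed.

(** * The uniform law on the unit interval *)

Section uniform01.
Context {R : realType}.

(* [measurableTypeR R] is [R] with its Borel sets, under another display. *)
Definition uniform01 : probability (measurableTypeR R) R :=
  uniform_prob (@ltr01 R).

Lemma uniform01E (A : set R) : measurable A ->
  uniform01 A = lebesgue_measure (A `&` `[0, 1]).
Proof.
move=> mA; rewrite -[A in LHS]setIT -integral_indic// integral_uniform//=.
  by rewrite subr0 invr1 mul1e integral_indic.
exact/measurable_EFinP/measurable_indic.
Qed.

Lemma uniform01_countable (A : set R) : countable A -> uniform01.-negligible A.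
Proof.
move=> cA; have mA : measurable A by exact: countable_measurable.
apply/negligibleP => //.
have /null_content_dominatesP := dominates_uniform_prob (@ltr01 R).
by apply => //; exact: countable_lebesgue_measure0.
Qed.

(** Nothing is assumed about [A] at 0 and 1, where quantile functions will take a default value. The
    trace of [A] on [0, 1] lies between []0, p[] and [0, p] with the point 1 added, both of Lebesgue
    measure [p]. *)
Lemma uniform01_le (A : set R) (p : R) : measurable A -> 0 <= p <= 1 ->
  (forall u, 0 < u < 1 -> A u <-> u <= p) -> uniform01 A = p%:E.
Proof.
move=> mA /andP[p0 p1] Ap; rewrite uniform01E//; apply/eqP; rewrite eq_le.
have mI : measurable (A `&` `[0, 1]) by exact: measurableI.
apply/andP; split; last first.
  have -> : p%:E = lebesgue_measure (`]0, p[%classic : set R).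
    rewrite lebesgue_measure_itv/= lte_fin sube0; case: ltgtP p0 => // <-//.
  rewrite le_measure ?inE// => u /=; rewrite in_itv/= => /andP[u0 up].
  have u1 := lt_le_trans up p1.
  by split; [apply/Ap; [rewrite u0|exact: ltW]|rewrite in_itv/= !ltW].
have sub : A `&` `[0, 1] `<=` `[0, p] `|` [set 1].
  move=> u [Au] /=; rewrite !in_itv/= => /andP[u0 u1].
  have [->|] := eqVneq u 1; first by right.
  rewrite neq_lt => /orP[ul1|]; last by rewrite ltNge u1.
  left; rewrite u0/=.
  move: u0; rewrite le_eqVlt => /predU1P[<-//|u0].
  by apply/Ap => //; rewrite u0.
apply: (@le_trans _ _ (lebesgue_measure (`[0, p]%classic `|` [set 1]))).
  by rewrite le_measure ?inE//; exact: measurableU.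
apply: (le_trans (measureU2 _ _ _)) => //.
rewrite [X in (_ + X)%E]lebesgue_measure_set1 adde0.
rewrite [X in (X <= _)%E]lebesgue_measure_itv/= lte_fin sube0.
by case: ifPn => //; rewrite lee_fin.
Qed.

End uniform01.

(** * Realisation of a law by its quantile function *)

Section quantile_rv.
Context d (T : measurableType d) (R : realType) (P : probability T R).
Variable X : {RV P >-> R}.

Definition quantile_rv : measurableTypeR R -> R := quantile X \_ `]0, 1[.

Let measurable_quantile_rv : measurable_fun setT quantile_rv.
Proof. by apply: measurable_nondecreasing_itv; exact: quantile_nd. Qed.

HB.instance Definition _ :=
  isMeasurableFun.Build _ _ _ _ quantile_rv measurable_quantile_rv.

Lemma quantile_rvE u : 0 < u < 1 -> quantile_rv u = quantile X u.
Proof. by move=> u01; rewrite /quantile_rv patchE mem_set//= in_itv. Qed.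

(** By [quantile_le], on []0, 1[] the quantile at u is at most x exactly when u <= P(X <= x), an
    event of uniform probability P(X <= x). So the distribution functions agree, which determines
    the laws. *)
Lemma distribution_quantile (A : set R) : measurable A ->
  distribution uniform01 quantile_rv A = distribution P X A.
Proof.
have cdfE x : distribution uniform01 quantile_rv `]-oo, x] =
    distribution P X `]-oo, x].
  have PX : P [set w | X w <= x] \is a fin_num.
    by rewrite fin_num_measure//; exact: measurable_set_le.
  rewrite /distribution /pushforward /= set_itvE /= -(fineK PX).
  apply: uniform01_le.
  - exact: (@measurable_set_le _ (measurableTypeR R)).
  - rewrite -!lee_fin fineK// measure_ge0 probability_le1//.
    exact: measurable_set_le.
  - by move=> u u01 /=; rewrite quantile_rvE// quantile_le// -lee_fin fineK.
(* The open right rays are stable under intersection and generate the Borel sets; [cdfE] reaches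
   them by complementation. *)
apply: (measure_unique (@RGenOInfty.G R) (fun n => `]- n%:R, +oo[%classic)).
- exact: RGenOInfty.measurableE.
- move=> _ _ [x ->] [y ->]; exists (Num.max x y).
  by apply/seteqP; split => z /=; rewrite !in_itv/= !andbT gt_max => /andP.
- by move=> i; exists (- i%:R).
- rewrite -subTset => z _ /=; exists (Num.truncn (- z)).+1 => //=.
  by rewrite in_itv/= andbT ltrNl truncnS_gt.
- move=> _ [x ->]; rewrite -setCitvl.
  have mE (m : probability R R) :
      m (~` `]-oo, x]%classic) = (1 - m `]-oo, x]%classic)%E.
    exact: probability_setC.
  apply: (etrans (mE (distribution uniform01 quantile_rv))).
  apply: (etrans _ (esym (mE (distribution P X)))).
  by congr (_ - _)%E; exact: cdfE.
- by move=> k; rewrite (le_lt_trans (probability_le1 _ _))// ltry.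
Qed.

End quantile_rv.

(** * Helly's selection theorem *)

Lemma helly_selection (R : realType) (a b : R) (f : nat -> R -> R)
    (M : R -> R) :
  (forall k, {in `]a, b[ &, nondecreasing_fun (f k)}) ->
  (forall u k, u \in `]a, b[ -> `|f k u| <= M u) ->
  exists m : nat -> nat, strictly_increasing m /\ exists g : R -> R,
    {in `]a, b[ &, nondecreasing_fun g} /\ exists2 N : set R, countable N &
    forall u, u \in `]a, b[ -> ~ N u -> f (m k) u @[k --> \oo] --> g u.
Proof.
move=> fnd fM.
pose I : set rat := [set r | ratr r \in `]a, b[].
(* The extraction runs over all rationals, so [v] is set to 0 off the interval; the absolute value
   in [vM] keeps the bound nonnegative there, where [M] is arbitrary. *)
pose v k (r : rat) : R := if ratr r \in `]a, b[ then f k (ratr r) else 0.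
have vM k r : `|v k r| <= `|M (ratr r)|.
  rewrite /v; case: ifPn => [rab|_]; last by rewrite normr0.
  by rewrite (le_trans (fM _ _ rab))// ler_norm.
have [m [mlt [l vl]]] := pointwise_subsequence vM.
have fl r : I r -> f (m k) (ratr r) @[k --> \oo] --> l r.
  by move=> Ir; have := vl r; rewrite /v Ir.
have lnd r s : I r -> I s -> r <= s -> l r <= l s.
  move=> Ir Is rs; apply: (ler_cvg_to (fl _ Ir) (fl _ Is)).
  by apply: nearW => k; apply: fnd => //; rewrite ler_rat.
(* [L u] and [U u] collect the limits at rationals to the left and to the right of [u]; their
   supremum [g] and infimum [h] enclose every limit value at [u]. *)
pose L (u : R) := [set l r | r in [set r | I r /\ ratr r < u]].
pose U (u : R) := [set l r | r in [set r | I r /\ u < ratr r]].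
have L0 u : u \in `]a, b[ -> L u !=set0.
  rewrite in_itv/= => /andP[au ub]; have [r] := rat_in_itvoo au.
  rewrite in_itv/= => /andP[ar ru]; exists (l r), r => //.
  by split => //; rewrite /I/= in_itv/= ar (lt_trans ru).
have U0 u : u \in `]a, b[ -> U u !=set0.
  rewrite in_itv/= => /andP[au ub]; have [r] := rat_in_itvoo ub.
  rewrite in_itv/= => /andP[ur rb]; exists (l r), r => //.
  by split => //; rewrite /I/= in_itv/= rb (lt_trans au).
have LU u x y : L u x -> U u y -> x <= y.
  move=> [r [Ir ru] <-] [s [Is us] <-]; apply: lnd => //.
  by rewrite -(ler_rat R) ltW// (lt_trans ru).
have hL u : u \in `]a, b[ -> has_sup (L u).
  move=> uab; split; first exact: L0.
  by have [y Uy] := U0 _ uab; exists y => x /LU; exact.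
have hU u : u \in `]a, b[ -> has_inf (U u).
  move=> uab; split; first exact: U0.
  by have [y Uy] := L0 _ uab; exists y => x; exact: LU.
pose g u := sup (L u); pose h u := inf (U u).
(* A rational [r] between [u] and [w] gives [h u <= l r <= g w]. *)
have hg u w : u \in `]a, b[ -> w \in `]a, b[ -> u < w -> h u <= g w.
  move=> uab wab uw; have [r] := rat_in_itvoo uw.
  rewrite in_itv/= => /andP[ur rw].
  have Ir : I r.
    move: uab wab; rewrite /I/= !in_itv/= => /andP[au _] /andP[_ wb].
    by rewrite (lt_trans au ur) (lt_trans rw wb).
  apply: (@le_trans _ _ (l r)).
    by apply: ge_inf; [exact: (hU _ uab).2|exists r].
  by apply: ub_le_sup; [exact: (hL _ wab).2|exists r].
have gh u : u \in `]a, b[ -> g u <= h u.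
  move=> uab; apply: ge_sup; first exact: L0.
  by move=> x Lx; apply: lb_le_inf; [exact: U0|move=> y; exact: LU].
exists m; split => //; exists g; split.
  move=> u w uab wab; rewrite le_eqVlt => /predU1P[->//|uw].
  by rewrite (le_trans (gh _ uab))// hg.
(* The exceptional points are the jumps. By [hg] the gaps between [g u] and [h u] are disjoint, so
   choosing a rational in each is injective. *)
exists [set u | (u \in `]a, b[) /\ (g u < h u)].
  have c u : exists r : rat,
      (u \in `]a, b[) /\ (g u < h u) -> g u < ratr r < h u.
    have [[uab gu]|ngh] := pselect ((u \in `]a, b[) /\ (g u < h u)); last first.
      by exists 0.
    by have [r] := rat_in_itvoo gu; rewrite in_itv/=; exists r.
  have [C CP] := choice c.
  apply/countable_injP; exists (pickle \o C) => u w /[!inE] Nu Nw /=.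
  move=> /(pcan_inj pickleK) Cuw.
  have := CP _ Nu; have := CP _ Nw; rewrite -Cuw.
  move=> /andP[gwC Chw] /andP[guC Chu].
  case: (ltgtP u w) => // uw.
    by have := lt_trans gwC Chu; rewrite ltNge hg//; [exact: Nu.1|exact: Nw.1].
  by have := lt_trans guC Chw; rewrite ltNge hg//; [exact: Nw.1|exact: Nu.1].
move=> u uab Nu.
have ghE : g u = h u.
  by apply/eqP; rewrite eq_le gh//= leNgt; apply/negP => ?; exact: Nu.
apply/cvgrPdist_lt => e e0.
(* Off the jumps, [f (m k) u] is squeezed between the values at rationals [r < u < s] whose limits
   are within [e] of [g u = h u]. *)
have [_ [r [Ir ru] <-] lr] := sup_adherent e0 (hL _ uab).
have [_ [s [Is us] <-] ls] := inf_adherent e0 (hU _ uab).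
near=> k; rewrite distrC ltr_distl; apply/andP; split.
  apply: (@lt_le_trans _ _ (f (m k) (ratr r))); last by rewrite fnd// ltW.
  by near: k; exact: (cvgr_gt (l r) (fl _ Ir)).
apply: (@le_lt_trans _ _ (f (m k) (ratr s))); first by rewrite fnd// ltW.
by rewrite ghE; near: k; exact: (cvgr_lt (l s) (fl _ Is)).
Unshelve. all: by end_near. Qed.

(** * Prokhorov's theorem on the line *)

Lemma bounded_fun_le (T : Type) (R : realType) (f : T -> R) :
  bounded_fun f -> exists M : R, forall x, `|f x| <= M.
Proof.
move=> /pinfty_ex_gt0[M _ fM]; exists M => x.
exact: fM.
Qed.

Lemma integral_distribution_bounded d (T : measurableType d) (R : realType)
    (P : probability T R) (X : {RV P >-> R}) (f : R -> R) (M : R) :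
  continuous f -> (forall x, `|f x| <= M) ->
  ('E_(distribution P X)[f] = \int[P]_w (f (X w))%:E)%E.
Proof.
move=> cf fM; have mf : measurable_fun setT f by exact: continuous_measurable_fun.
rewrite unlock integral_distribution//; first exact/measurable_EFinP.
apply: measurable_bounded_integrable => //.
- by rewrite (le_lt_trans (probability_le1 _ _))// ltry.
- exact: measurableT_comp.
- exists M; split; first exact: num_real.
  by move=> y My x _ /=; rewrite (le_trans (fM _))// ltW.
Qed.

Lemma tight_weakly_convergent d (T : measurableType d) (R : realType)
    (P : probability T R) (X : nat -> {RV P >-> R}) :
  bounded_in_probability (range X) ->
  exists2 m : nat -> nat, strictly_increasing m &
    weakly_convergent (fun k => distribution P (X (m k))).
Proof.
move=> bX.
(* Tightness at level [Num.min u (1 - u)] bounds the quantiles at [u] uniformly in [k]. *)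
have qM u : exists M, forall k, u \in `]0, 1[ -> `|quantile (X k) u| <= M.
  have [u01|] := boolP (u \in `]0, 1[); last by exists 0.
  have u01' := u01; rewrite in_itv/= in u01'.
  have e0 : 0 < Num.min u (1 - u).
    by case/andP: u01' => u0 u1; rewrite lt_min u0 subr_gt0.
  have [M _ PM] := bX _ e0; exists M => k _; apply: quantile_bound => //.
  apply: le_lt_trans PM; apply: ereal_sup_ubound => /=.
  by exists (X k); [exists k|].
have [M qM'] := choice qM.
have [m [mlt [g [gnd [N cN qg]]]]] := helly_selection
  (fun k => quantile_nd (X k)) (fun u k => qM' u k).
have mg : measurable_fun [set: measurableTypeR R] (g \_ `]0, 1[).
  exact: measurable_nondecreasing_itv.
pose G : {mfun measurableTypeR R >-> R} :=
  HB.pack (g \_ `]0, 1[ : measurableTypeR R -> R)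
    (isMeasurableFun.Build _ _ _ _ _ mg).
exists m => //; exists (distribution uniform01 G) => f cf /bounded_fun_le[K fK].
have mf : measurable_fun setT f by exact: continuous_measurable_fun.
rewrite (integral_distribution_bounded _ cf fK).
(* Equality of laws turns all the expectations into integrals over one space, where dominated
   convergence applies. *)
rewrite (_ : (fun k => _) = fun k =>
  (\int[uniform01]_u (f (quantile_rv (X (m k)) u))%:E)%E); last first.
  apply/funext => k; rewrite -(integral_distribution_bounded _ cf fK).
  rewrite unlock; apply: eq_measure_integral => A mA _.
  by apply/esym; exact: distribution_quantile.
have [| | | | |_ _] := @dominated_convergence _ (measurableTypeR R) R uniform01
  setT measurableT (fun k u => (f (quantile_rv (X (m k)) u))%:E)
  (fun u => (f (G u))%:E) (cst K%:E); last by apply.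
- by move=> k; apply/measurable_EFinP/measurableT_comp.
- by apply/measurable_EFinP/measurableT_comp.
(* Off [N] there is convergence everywhere: by Helly inside []0, 1[], and outside because both sides
   are the default 0. *)
- apply: negligibleS (uniform01_countable cN) => u /= /not_implyP[_ ncv].
  apply: contrapT => nNu; apply: ncv.
  have qG : quantile_rv (X (m k)) u @[k --> \oo] --> (g \_ `]0, 1[) u.
    rewrite patchE; case: ifPn => [/set_mem uab|nuab].
      under eq_fun do rewrite quantile_rvE//.
      exact: qg.
    under eq_fun do rewrite /quantile_rv patchE (negbTE nuab).
    exact: cvg_cst.
  by apply: cvg_EFin; [exact: nearW|exact: (cvg_comp _ _ qG (cf _))].
- exact: finite_measure_integrable_cst.
- by apply: aeW => u k _; rewrite /= lee_fin fK.
Qed.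

(** * Equivalent measures, L^1-bounds and boundedness in probability *)

Section equivalent_measures.
Context d (T : measurableType d) (R : realType).
Implicit Types P Q : probability T R.

Lemma ae_null_dominates P Q (p : T -> Prop) : Q `<< P ->
  {ae P, forall w, p w} -> {ae Q, forall w, p w}.
Proof.
move=> /null_content_dominatesP QP [A [mA A0 pA]]; exists A; split => //.
exact: QP.
Qed.

(** The epsilon-delta form of absolute continuity, read off the continuity of the total variation of
    [P] seen as a charge. *)
Lemma null_dominates_continuous P Q : P `<< Q -> forall e : R, 0 < e ->
  exists2 r : R, 0 < r &
    forall A, measurable A -> (Q A < r%:E)%E -> (P A < e%:E)%E.
Proof.
move=> PQ e e0.
pose nu : {charge set T -> \bar R} := charge_of_finite_measure P.
have [p [n pn]] := Hahn_decomposition nu.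
have [|r [r0 rP]] := @charge_variation_continuous _ _ _ nu _ _ pn Q _ e e0.
  exact: PQ.
exists r => // A mA QA; apply: le_lt_trans (rP _ mA QA).
by rewrite (le_trans _ (abse_charge_variation pn mA))// lee_abs.
Qed.

(** By the triangle inequality the hull has the same bound as [K]. Convex combinations are given
    [P]-a.s. and are transferred to [Q] by domination. *)
Lemma L1_bounded_conv_hull P Q (K : set {RV P >-> R}) : Q `<< P ->
  L1_bounded Q [set (X : T -> R) | X in K] ->
  L1_bounded Q [set (X : T -> R) | X in conv_hull K].
Proof.
move=> QP; apply: le_lt_trans; set S := leRHS.
apply: ge_ereal_sup => _ [_ [X [N [c [Y [c0 c1 KY XY]]]] <-] <-].
have mY i : measurable_fun setT (fun w => `|Y i w|%:E).
  by apply/measurable_EFinP; exact: measurableT_comp.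
apply: (@le_trans _ _ (\int[Q]_w (\sum_(i < N) (c i * `|Y i w|)%:E))%E).
  rewrite unlock; apply: ae_ge0_le_integral => //.
  - by apply/measurable_EFinP; exact: measurableT_comp.
  - by move=> w _; apply: sume_ge0 => i _; rewrite lee_fin mulr_ge0.
  - apply: emeasurable_sum => i; under eq_fun do rewrite EFinM.
    exact: measurable_funeM.
  - apply: ae_null_dominates QP _; apply: filterS XY => w -> _.
    rewrite sumEFin lee_fin.
    rewrite (le_trans (ler_norm_sum _ _ _))// ler_sum// => i _.
    by rewrite normrM ger0_norm.
rewrite ge0_integral_sum//; last 2 first.
- move=> i; under eq_fun do rewrite EFinM.
  exact: measurable_funeM.
- by move=> i w _; rewrite lee_fin mulr_ge0.
apply: (@le_trans _ _ (\sum_(i < N) (c i)%:E * S)%E); last first.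
  by rewrite -ge0_sume_distrl ?sumEFin ?c1 ?mul1e// => i _; rewrite lee_fin.
apply: lee_sum => i _; under eq_integral do rewrite EFinM.
rewrite ge0_integralZl// ?lee_fin//.
apply: lee_wpmul2l; first by rewrite lee_fin.
apply: ereal_sup_ubound; exists (Y i : T -> R); first by exists (Y i).
by rewrite unlock.
Qed.

Lemma L1_bounded_in_probability P Q (K : set {RV P >-> R}) : P `<< Q ->
  L1_bounded Q [set (X : T -> R) | X in K] -> bounded_in_probability K.
Proof.
move=> PQ; rewrite /L1_bounded; set S := ereal_sup _ => Soo e e0.
(* Half of [e] is aimed at, since a supremum of values below [e / 2] is still strictly below [e]. *)
have e20 : 0 < e / 2 by rewrite divr_gt0.
have [r r0 rP] := null_dominates_continuous PQ e20.
(* The maximum gives [0 <= B] without supposing [K] nonempty. *)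
pose B := Num.max 0 (fine S).
have SB X : K X -> ('E_Q[(fun w => `|X w|)%R] <= B%:E)%E.
  move=> KX; have ES : ('E_Q[(fun w => `|X w|)%R] <= S)%E.
    by apply: ereal_sup_ubound; exists (X : T -> R) => //; exists X.
  apply: (le_trans ES); rewrite /B EFin_max le_max.
  have S0 : (0 <= S)%E by apply: le_trans ES; exact: expectation_ge0.
  by rewrite fineK ?lexx ?orbT// ge0_fin_numE.
have B0 : 0 <= B by rewrite le_max lexx.
(* Chosen so that [M * r = B + 1] exceeds [B]: by Markov's inequality the [Q]-probability of |X| >=
   M is then below [r]. *)
pose M := (B + 1) / r.
have M0 : 0 < M by rewrite divr_gt0// ltr_wpDl.
exists M => //; apply: (@le_lt_trans _ _ (e / 2)%:E); last first.
  by rewrite lte_fin ltr_pdivrMr// ltr_pMr// ltr1n.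
apply: ge_ereal_sup => _ [X KX <-]; apply/ltW/rP.
  by apply: measurable_set_lt => //; exact: measurableT_comp.
have := @le_integral_abse _ _ _ Q setT measurableT (EFin \o X) M _ M0.
rewrite setTI => /(_ _)/le_trans H.
have : (M%:E * Q [set w | (M <= `|X w|)%R] <= B%:E)%E.
  apply: H; first exact/measurable_EFinP.
  by have := SB _ KX; rewrite unlock.
have mM : measurable [set w | M <= `|X w|].
  by apply: measurable_set_le => //; exact: measurableT_comp.
have mM' : measurable [set w | M < `|X w|].
  by apply: measurable_set_lt => //; exact: measurableT_comp.
move=> QB; apply: (@le_lt_trans _ _ (Q [set w | M <= `|X w|])).
  by rewrite le_measure ?inE// => w /= /ltW.
move: QB; rewrite -(fineK (fin_num_measure Q _ mM)) -EFinM lee_fin lte_fin => QB.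
rewrite ltNge; apply/negP => rQ.
have : M * r <= B by rewrite (le_trans _ QB)// ler_pM2l.
by rewrite /M divfK ?gt_eqF//; lra.
Qed.

End equivalent_measures.

(** * Cesaro means, convex hulls and subsequences *)

Lemma cesaro_mean_conv_hull d (T : measurableType d) (R : realType)
    (P : probability T R) (X : nat -> {RV P >-> R}) (k : nat) :
  conv_hull (range X) (cesaro_mean X k).
Proof.
exists k.+1, (fun=> k.+1%:R^-1), (fun i : 'I_k.+1 => X i); split => //.
- by rewrite sumr_const card_ord -[LHS]mulr_natr mulVf// pnatr_eq0.
- apply: aeW => w; rewrite /cesaro_mean /= mfun_sum mulr_suml.
  by apply: eq_bigr => i _; rewrite mulrC.
Qed.

Section subsets.
Context d (T : measurableType d) (R : realType) (P : probability T R).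

Lemma conv_hull_subset (K : set {RV P >-> R}) : K `<=` conv_hull K.
Proof.
move=> X KX; exists 1%N, (fun=> 1), (fun=> X); split => //.
- by rewrite big_ord1.
- by apply: aeW => w; rewrite big_ord1 mul1r.
Qed.

Lemma L1_bounded_subset (Q : probability T R) (A B : set (T -> R)) :
  A `<=` B -> L1_bounded Q B -> L1_bounded Q A.
Proof.
by move=> AB; apply: le_lt_trans; apply/ereal_sup_le/image_subset.
Qed.

Lemma bounded_in_probability_subset (A B : set {RV P >-> R}) :
  A `<=` B -> bounded_in_probability B -> bounded_in_probability A.
Proof.
move=> AB bB e e0; have [M M0 BM] := bB e e0; exists M => //.
by apply: le_lt_trans BM; apply/ereal_sup_le/image_subset.
Qed.

End subsets.

Lemma strictly_increasing_cvgn (m : nat -> nat) :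
  strictly_increasing m -> m k @[k --> \oo] --> \oo.
Proof.
move=> mlt; have mk k : (k <= m k)%N.
  by elim: k => // k /leq_ltn_trans; apply; exact: mlt.
move=> A [N _ NA]; exists N => // k /= Nk; apply: NA => /=.
exact: leq_trans (mk k).
Qed.

(** * Mass lost at infinity under weak convergence *)

Section mass_at_infinity.
Context {R : realType}.

(** A bounded continuous test function that detects mass near infinity: it tends to 1 at +oo for
    fixed [n], and to 0 at each real point as [n] grows. *)
Definition cutoff (n : nat) (x : R) : R := `|x| / (`|x| + n.+1%:R).

Let den_gt0 n (x : R) : 0 < `|x| + n.+1%:R.
Proof. by rewrite ltr_wpDl. Qed.

Lemma cutoff_ge0 n x : 0 <= cutoff n x.
Proof. by rewrite divr_ge0// ltW. Qed.

Lemma cutoff_le1 n x : `|cutoff n x| <= 1.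
Proof. by rewrite ger0_norm ?cutoff_ge0// ler_pdivrMr// mul1r lerDl. Qed.

Lemma continuous_cutoff n : continuous (cutoff n).
Proof.
move=> x; apply: cvgM; first exact: norm_continuous.
apply: cvgV; first by rewrite gt_eqF.
by apply: cvgD; [exact: norm_continuous|exact: cvg_cst].
Qed.

Lemma cvg_cutoffy n : cutoff n x @[x --> +oo] --> (1 : R).
Proof.
apply/cvgrPdist_lt => e e0; near=> x.
have x0 : 0 < x by near: x; exact: nbhs_pinfty_gt.
have -> : 1 - cutoff n x = n.+1%:R / (`|x| + n.+1%:R).
  by rewrite /cutoff; field; rewrite gt_eqF.
rewrite ger0_norm ?divr_ge0// ?ltW// ltr_pdivrMr// gtr0_norm//.
apply: (@lt_le_trans _ _ (e * x)); last by rewrite ler_wpM2l// ?lerDl// ltW.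
by rewrite -ltr_pdivrMl//; near: x; exact: nbhs_pinfty_gt (num_real _).
Unshelve. all: by end_near. Qed.

Lemma cvg_cutoff0 x : cutoff n x @[n --> \oo] --> (0 : R).
Proof.
apply/cvgrPdist_lt => e e0; near=> n.
rewrite sub0r normrN ger0_norm ?cutoff_ge0// ltr_pdivrMr//.
apply: (@lt_le_trans _ _ (e * n.+1%:R)); last by rewrite ler_wpM2l// ?lerDr// ltW.
rewrite mulrC -ltr_pdivrMr//; apply: lt_trans (_ : n%:R < _); last first.
  by rewrite ltr_nat.
by near: n; exact: nbhs_infty_gtr.
Unshelve. all: by end_near. Qed.

(** Two limits are taken in order. With [n] fixed and [k] growing, P(xi = +oo) is at most the
    [nu]-expectation of [cutoff n]; as [n] grows this tends to 0, because [nu] lives on the real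
    line. *)
Lemma weakly_convergent_ae_lty d (T : measurableType d) (P : probability T R)
    (X : nat -> {RV P >-> R}) (xi : T -> \bar R) :
  measurable_fun setT xi ->
  {ae P, forall w, (X k w)%:E @[k --> \oo] --> xi w} ->
  weakly_convergent (fun k => distribution P (X k)) ->
  {ae P, forall w, (xi w < +oo)%E}.
Proof.
move=> mxi Xxi [nu Xnu]; pose A := [set w | xi w = +oo%E].
have mA : measurable A.
  by rewrite -[A]setTI; apply: (mxi measurableT [set +oo%E]).
have mcut n : measurable_fun setT (cutoff n).
  by apply: continuous_measurable_fun; exact: continuous_cutoff.
have cut_bound n : bounded_fun (cutoff n).
  exists 1; split => // y y1 x _ /=.
  by rewrite (le_trans (cutoff_le1 _ _))// ltW.
have PA_le n : (P A <= 'E_nu[cutoff n])%E.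
  have cvgA : (\int[P]_(w in A) (cutoff n (X k w))%:E)%E @[k --> \oo] --> P A.
    have [| | | | |_ _] := @dominated_convergence _ T R P A mA
      (fun k w => (cutoff n (X k w))%:E) (cst 1%:E) (cst 1%:E).
    - move=> k; apply/measurable_EFinP; apply: measurable_funTS.
      exact: measurableT_comp.
    - exact: measurable_cst.
    - apply: filterS Xxi => w Xw Aw; rewrite Aw in Xw.
      have Xy : X k w @[k --> \oo] --> +oo by exact/cvgeryP.
      by apply: cvg_EFin; [exact: nearW|exact: cvg_comp Xy (cvg_cutoffy n)].
    - exact: finite_measure_integrable_cst.
    - by apply: aeW => w k _ /=; rewrite lee_fin cutoff_le1.
    - by rewrite integral_cst//= mul1e.
  have cvgN := Xnu _ (@continuous_cutoff n) (cut_bound n).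
  apply: (lee_cvg_to cvgA cvgN).
  (* The cutoff is nonnegative, so its integral over [A] is at most its full expectation. *)
  apply: nearW => k.
  rewrite (integral_distribution_bounded _ (@continuous_cutoff n) (cutoff_le1 n)).
  apply: ge0_subset_integral => //.
    by apply/measurable_EFinP; exact: measurableT_comp.
  by move=> w _; rewrite lee_fin cutoff_ge0.
have nu0 : ('E_nu[cutoff n])%E @[n --> \oo] --> 0%E.
  have [| | | | |_ _] := @dominated_convergence _ _ R nu setT measurableT
      (fun n x => (cutoff n x)%:E) (cst 0%:E) (cst 1%:E).
  - by move=> n; exact/measurable_EFinP.
  - exact: measurable_cst.
  - by apply: aeW => x _; apply: cvg_EFin; [exact: nearW|exact: cvg_cutoff0].
  - exact: finite_measure_integrable_cst.
  - by apply: aeW => x n _ /=; rewrite lee_fin cutoff_le1.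
  - by rewrite unlock integral0.
exists A; split => //; last first.
  by move=> w /= /negP; rewrite -leNgt leye_eq => /eqP.
apply/eqP; rewrite -measure_le0; apply: (lee_cvg_to (cvg_cst _) nu0).
exact: nearW.
Qed.

End mass_at_infinity.

(** * Equivalence of the seven statements *)

Theorem corollary2p12 (R : realType) (d : measure_display)
    (T : measurableType d) (P : probability T R)
    (xi_ : nat -> {RV P >-> R}) (n : nat -> nat) (xi : T -> \bar R)
    (xi_nonneg : forall j, L0_nonneg (xi_ j))
    (n_incr : strictly_increasing n)
    (xi_meas : measurable_fun [set: T] xi)
    (xi_ge0 : forall w, (0 <= xi w)%E)
    (xi_cesaro : cesaro_ae_cvg (fun k => xi_ (n k)) xi)
    (xi_fin_bounded : exists2 Q : probability T R, equivalent_prob Q P &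
      L1_bounded Q (range (fun (k : nat) (w : T) =>
        xi_ (n k) w * \1_[set w' | (xi w' < +oo)%E] w))) :
  let barxi : nat -> {RV P >-> R} := cesaro_mean (fun k => xi_ (n k)) in
  let C := conv_hull (range (fun k => xi_ (n k))) in
  let barC := conv_hull (range barxi) in
  [<-> {ae P, forall w, (xi w < +oo)%E};
       bounded_in_probability C;
       bounded_in_probability barC;
       exists2 Q : probability T R, equivalent_prob Q P &
         L1_bounded Q (range (fun k => xi_ (n k) : T -> R));
       exists2 Q : probability T R, equivalent_prob Q P &
         L1_bounded Q (range (fun k => barxi k : T -> R));
       forall eta : nat -> {RV P >-> R}, (forall j, C (eta j)) ->
         exists2 m : nat -> nat, strictly_increasing m &
           weakly_convergent (fun k => distribution P (eta (m k)));
       forall eta : nat -> {RV P >-> R}, (forall j, barC (eta j)) ->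
         exists2 m : nat -> nat, strictly_increasing m &
           weakly_convergent (fun k => distribution P (eta (m k)))].
Proof.
move=> barxi C barC.
have barxiC k : C (barxi k) by exact: cesaro_mean_conv_hull.
have barxibarC k : barC (barxi k) by apply: conv_hull_subset; exists k.
(* Stated for any [K] containing the Cesaro means, so as to serve both [C] and [barC]. *)
have weak_fin K : (forall k, K (barxi k)) ->
    (forall eta : nat -> {RV P >-> R}, (forall j, K (eta j)) ->
      exists2 m : nat -> nat, strictly_increasing m &
        weakly_convergent (fun k => distribution P (eta (m k)))) ->
    {ae P, forall w, (xi w < +oo)%E}.
  move=> Kbarxi /(_ _ Kbarxi)[m mlt]; apply: weakly_convergent_ae_lty => //.
  apply: filterS xi_cesaro => w.
  exact: cvg_comp (strictly_increasing_cvgn mlt).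
have tight_weak (K : set {RV P >-> R}) : bounded_in_probability K ->
    forall eta : nat -> {RV P >-> R}, (forall j, K (eta j)) ->
      exists2 m : nat -> nat, strictly_increasing m &
        weakly_convergent (fun k => distribution P (eta (m k))).
  move=> bK eta Keta; apply: tight_weakly_convergent.
  by apply: bounded_in_probability_subset bK => _ [j _ <-].
(* Under (i) the indicator in assumption (b) is 1 [P]-a.s., hence [Q]-a.s., so the [Q] of (b) bounds
   the sequence itself. *)
have fin_L1 : {ae P, forall w, (xi w < +oo)%E} ->
    exists2 Q : probability T R, equivalent_prob Q P &
      L1_bounded Q (range (fun k => xi_ (n k) : T -> R)).
  move=> xioo; have [Q [QP PQ] bQ] := xi_fin_bounded; exists Q => //.
  apply: le_lt_trans bQ; apply: ge_ereal_sup => _ [_ [k _ <-] <-].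
  apply: ereal_sup_ubound; eexists; first by exists k.
  have mxioo : measurable [set w | (xi w < +oo)%E].
    by rewrite -[X in measurable X]setTI; exact: emeasurable_fun_infty_o.
  rewrite unlock; apply: ae_eq_integral => //.
  - apply/measurable_EFinP/measurableT_comp => //.
    by apply: measurable_funM => //; exact: measurable_indic.
  - by apply/measurable_EFinP; exact: measurableT_comp.
  - apply: filterS (ae_null_dominates QP xioo) => w xiw _.
    by rewrite indicE mem_set// mulr1.
have L1_C (Q : probability T R) : equivalent_prob Q P ->
    L1_bounded Q (range (fun k => xi_ (n k) : T -> R)) ->
    L1_bounded Q [set (Y : T -> R) | Y in C].
  move=> [QP PQ] bQ; apply: L1_bounded_conv_hull => //.
  by apply: L1_bounded_subset bQ => _ [_ [k _ <-] <-]; exists k.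
have L1_barC (Q : probability T R) : equivalent_prob Q P ->
    L1_bounded Q (range (fun k => barxi k : T -> R)) ->
    L1_bounded Q [set (Y : T -> R) | Y in barC].
  move=> [QP PQ] bQ; apply: L1_bounded_conv_hull => //.
  by apply: L1_bounded_subset bQ => _ [_ [k _ <-] <-]; exists k.
have L1_L1bar (Q : probability T R) : equivalent_prob Q P ->
    L1_bounded Q (range (fun k => xi_ (n k) : T -> R)) ->
    L1_bounded Q (range (fun k => barxi k : T -> R)).
  move=> QP /(L1_C _ QP); apply: L1_bounded_subset => _ [k _ <-].
  by exists (barxi k).
have fin_bC : {ae P, forall w, (xi w < +oo)%E} -> bounded_in_probability C.
  move=> /fin_L1[Q QP /(L1_C _ QP)]; exact: L1_bounded_in_probability QP.2.
have L1_bbarC : (exists2 Q : probability T R, equivalent_prob Q P &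
    L1_bounded Q (range (fun k => barxi k : T -> R))) ->
    bounded_in_probability barC.
  by move=> [Q QP /(L1_barC _ QP)]; exact: L1_bounded_in_probability QP.2.
have fin_L1bar : {ae P, forall w, (xi w < +oo)%E} ->
    exists2 Q : probability T R, equivalent_prob Q P &
      L1_bounded Q (range (fun k => barxi k : T -> R)).
  by move=> /fin_L1[Q QP bQ]; exists Q => //; exact: L1_L1bar.
(* The cycle runs from (i) to (vii) and back to (i). The implications from (ii), (iii), (v) and (vi)
   to their successors pass through (i). *)
tfae.
- exact: fin_bC.
- by move=> /tight_weak/(weak_fin _ barxiC)/fin_L1bar; exact: L1_bbarC.
- by move=> /tight_weak/(weak_fin _ barxibarC); exact: fin_L1.
- by move=> [Q QP bQ]; exists Q => //; exact: L1_L1bar.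
- by move=> /L1_bbarC/tight_weak/(weak_fin _ barxibarC)/fin_bC/tight_weak.
- by move=> /(weak_fin _ barxiC)/fin_L1bar/L1_bbarC/tight_weak.
- exact: weak_fin.
Qed.
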